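(* For every integer $q>3$, $f(3,q)<3e^{1/2}\,2^q\,q!$.
   Context: A word over an alphabet is a finite string of letters; a subword of $w$ is a string of consecutive letters of $w$. A word $w$ contains a pattern $P$ if there is a map assigning to each letter of $P$ a nonempty word (different letters may receive equal words) such that the word obtained from $P$ by replacing each letter by its assigned word is a subword of $w$. $Z_3=x_1x_2x_1x_3x_1x_2x_1$. $f(3,q)$ denotes the smallest integer such that every word of length $f(3,q)$ over an alphabet of size $q$ contains $Z_3$. *)

(* Defs.v *)
From mathcomp Require Import all_boot all_order all_algebra.

Set Implicit Arguments.
Unset Strict Implicit.
Unset Printing Implicit Defensive.

(* The assignment [h] need not be injective on the letters of [P], and its
   values on letters not occurring in [P] are irrelevant. *)
Definition contains (V A : eqType) (P : seq V) (w : seq A) : Prop :=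
  exists h : V -> seq A,
    (forall x, x \in P -> h x != [::]) /\ infix (flatten (map h P)) w.

Definition Z3 : seq nat := [:: 1; 2; 1; 3; 1; 2; 1].

Definition forces_Z3 (q n : nat) : Prop :=
  forall w : n.-tuple 'I_q, contains Z3 w.

(* n = f(3, q). *)
Definition is_f3 (q n : nat) : Prop :=
  forces_Z3 q n /\ forall m : nat, forces_Z3 q m -> n <= m.

(* Main.v *)
Require Import Defs.
From mathcomp Require Import all_boot all_order all_algebra.
From mathcomp Require Import all_classical all_reals all_analysis.
From mathcomp Require Import zify ring lra.

Set Implicit Arguments.
Unset Strict Implicit.
Unset Printing Implicit Defensive.

Import Order.TTheory GRing.Theory Num.Theory.

(** Call a word of the form [a y a] with [a] a letter and [y] nonempty a Z2-word;
    a word avoids Z2-words iff equal letters are consecutive and at most two at a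
    time, so it has length at most [2 q]. In a word [w] avoiding [Z3], attach to
    each prefix containing a Z2-word the rightmost minimal one, a marker. A marker
    with [k + 1] distinct letters is determined by the sequence of these letters
    and by [k] bits giving run lengths. Two occurrences of a marker cannot be
    separated, since this would give [Z3]; hence there are essentially two of
    them, and each serves at most [2 (q - k)] prefixes because what follows it
    avoids Z2-words and (nearly) all its letters. Summing over the markers gives
    [2 q + \sum_(k < q) q ^_ k.+1 * 2 ^ k * 4 (q - k)], which [j = q - 1 - k] turns
    into a partial sum of [2 * 2 ^ q * q`! * \sum_j (j + 1) / (j! 2 ^ j)], and that
    series sums to [3 / 2 * e ^ (1 / 2)]. *)

(** * Words avoiding Z2, and their run-length encoding *)

Section Z2Free.
Variable T : eqType.
Implicit Types (x : T) (s t : seq T) (b : seq bool).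

(** [behead] lets [x] recur right after itself, the only recurrence that encloses no letter. *)
Fixpoint Z2free s : bool :=
  if s is x :: s' then (x \notin behead s') && Z2free s' else true.

Lemma Z2free_catr s1 s2 : Z2free (s1 ++ s2) -> Z2free s2.
Proof. by elim: s1 => //= x s1 IHs /andP[_ /IHs]. Qed.

Lemma Z2free_catl s1 s2 : Z2free (s1 ++ s2) -> Z2free s1.
Proof.
elim: s1 => //= x s1 IHs /andP[xs /IHs ->]; rewrite andbT.
by case: s1 xs {IHs} => //= y s1; rewrite mem_cat negb_or => /andP[].
Qed.

(** A letter on both sides of [x] would enclose a word containing [x], hence nonempty. *)
Lemma Z2free_pivot s1 x s2 :
  Z2free (s1 ++ x :: s2) -> {in s1, forall y, y \notin s2}.
Proof.
elim: s1 => //= y s1 IHs /andP[ys /IHs IH] z; rewrite inE => /orP[/eqP->|/IH//].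
case: s1 ys {IHs IH} => //= u s1.
by rewrite mem_cat inE !negb_or => /and3P[].
Qed.

(** A bit codes a run length: [false] for a single letter, [true] for a doubled one. *)
Definition expand t b : seq T :=
  flatten [seq nseq (xe.2 : bool).+1 xe.1 | xe <- zip t b].

Lemma Z2free_expand s : Z2free s ->
  exists t b, [/\ size b = size t, uniq t, t =i s & s = expand t b].
Proof.
(* Strong induction on the size: removing the first run may remove two letters. *)
have [n] := ubnP (size s); elim: n s => // n IHn [|x [|y s]] /=.
- by move=> _ _; exists [::], [::].
- by move=> _ _; exists [:: x], [:: false].
rewrite !ltnS => len /and3P[xs ys Zs].
have [eyx|neq_yx] := eqVneq x y; last first.
  have [|/=|t [b [szb ut mem_t def_s]]] := IHn (y :: s); rewrite ?ys //.
  exists (x :: t), (false :: b); split=> //=.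
  - by rewrite szb.
  - by rewrite ut mem_t inE negb_or neq_yx xs.
  - by move=> z; rewrite !inE mem_t inE.
  - by rewrite /expand /= -/(expand t b) -def_s.
subst y; have [|//|t [b [szb ut mem_t def_s]]] := IHn s; first exact: ltnW.
exists (x :: t), (true :: b); split=> //=.
- by rewrite szb.
- by rewrite ut mem_t xs.
- by move=> z; rewrite !inE mem_t orbA orbb.
- by rewrite /expand /= -/(expand t b) -def_s.
Qed.

Lemma size_Z2free s : Z2free s -> size s <= 2 * size (undup s).
Proof.
move=> /Z2free_expand[t [b [szb ut mem_t def_s]]].
have ->: size (undup s) = size t.
  apply/eqP; rewrite -uniq_size_uniq ?undup_uniq // => z.
  by rewrite mem_undup mem_t.
rewrite {}def_s {mem_t ut s}; elim: t b szb => [|x t IHt] [|e b] //= [/IHt].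
by rewrite /expand /= size_cat size_nseq; case: e => /=; lia.
Qed.

(** [x :: s'] is the shortest suffix that contains a Z2-word. *)
Lemma last_Z2 s : ~~ Z2free s ->
  exists s0 x s', [/\ s = s0 ++ x :: s', Z2free s' & x \in behead s'].
Proof.
elim: s => //= x s IHs; have [Zs|/IHs] := boolP (Z2free s).
  by rewrite andbT negbK => xs; exists [::], x, s.
by case=> s0 [y [s' [-> ? ?]]] _; exists (x :: s0), y, s'.
Qed.

(* The word [a y a] with [y] made of the runs of the letters of [t'] prescribed
   by [b]; the empty [t'] stands for [a a a]. *)
Definition marker t b : seq T :=
  if t is a :: t' then a :: rcons (if t' is [::] then [:: a] else expand t' b) a
  else [::].

End Z2Free.

(** * Splitting off a marker *)

Lemma marker_decomp (T : finType) (x : T) (s : seq T) :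
  Z2free s -> x \in behead s ->
  exists k t b r, [/\ [/\ size t = k.+1, size b = k & uniq t],
    x :: s = marker t b ++ r & size r <= 2 * (#|T| - k.+1) + (0 < k)].
Proof.
case: s => //= z s /andP[zs Zs] xs.
(* If [r] avoids the letters of [t], it has at most [#|T| - size t] distinct letters, each used at
   most twice. *)
have szuniq (t r : seq T) : Z2free r -> uniq t -> {in t, forall y, y \notin r} ->
    size r <= 2 * (#|T| - size t).
  move=> Zr ut tr; apply: leq_trans (size_Z2free Zr) _.
  have: uniq (t ++ undup r).
    rewrite cat_uniq ut undup_uniq andbT /=; apply/hasPn=> y.
    by rewrite mem_undup; apply: contraL => /tr.
  move/card_uniqP; rewrite size_cat => card_tr.
  have: #|t ++ undup r| <= #|T| by exact: max_card.
  rewrite card_tr leq_mul2l /= => le_tr; apply: leq_trans (leq_sub2r (size t) le_tr).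
  by rewrite addKn.
pose s1 := take (index x s) s; pose s2 := drop (index x s).+1 s.
have def_s : s = s1 ++ x :: s2.
  by rewrite -[LHS](cat_take_drop (index x s)) (drop_nth x) ?index_mem // nth_index.
have xs1 : x \notin s1.
  by rewrite /s1 in_take_leq ?ltnn // index_size.
(* If [z = x], the recurrence of [x] must come at once and the marker is [x x x]. *)
have [ezx|neq_zx] := eqVneq z x.
  have s1_nil : s1 = [::].
    case: s1 def_s xs1 => // y s1 def_s.
    by move: zs; rewrite ezx def_s /= mem_cat mem_head orbT.
  exists 0, [:: x], [::], s2; split=> //=; first by rewrite ezx def_s s1_nil.
  rewrite addn0; apply: (szuniq [:: x]) => //.
    by move: Zs; rewrite def_s s1_nil /= => /andP[].
  move=> y; rewrite inE => /eqP->.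
  by move: zs; rewrite ezx def_s s1_nil /=.
have Zzs : Z2free ((z :: s1) ++ x :: s2) by rewrite /= -def_s zs.
have [t [b [szb ut mem_t def_y]]] := Z2free_expand (Z2free_catl Zzs).
have xt : x \notin t by rewrite mem_t inE negb_or eq_sym neq_zx.
have t_gt0 : 0 < size t.
  by case: (t) mem_t => // /(_ z); rewrite mem_head.
exists (size t), (x :: t), b, s2; split=> //=.
- by split=> //; rewrite ut xt.
- rewrite cat_rcons; case: (t) def_y t_gt0 => // u t' <- _ /=.
  by rewrite def_s.
(* The closing [x] of the marker may be doubled, so only [behead s2] is sure to avoid [x]; this is
   the extra [0 < k]. *)
rewrite t_gt0 addn1; suff: size (behead s2) <= 2 * (#|T| - (size t).+1).
  by rewrite size_behead; case: (size s2).
have := Z2free_catr Zzs => /= /andP[xs2 Zs2].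
apply: (szuniq (x :: t)) => //=; rewrite ?xt //.
  by case: (s2) Zs2 => //= ? ? /andP[].
move=> y; rewrite inE => /orP[/eqP->//|]; rewrite mem_t => ys1.
by apply/negP=> /mem_behead; apply/negP; apply: Z2free_pivot Zzs _ ys1.
Qed.

(** * Occurrences of one marker in a word avoiding Z3 *)

Lemma mem_expand (T : eqType) (x : T) (t : seq T) b : x \in expand t b -> x \in t.
Proof.
case/flattenP=> s /mapP[[y e] yt ->]; rewrite mem_nseq => /eqP->.
by have := map_f fst yt; elim: (t) (b) {yt} => [|z t' IHt] [|e' b'] //=;
  rewrite !inE => /orP[->//|/IHt->]; rewrite orbT.
Qed.

Lemma marker_shape (T : eqType) k (t : seq T) b :
    size t = k.+1 -> size b = k -> uniq t ->
  exists a y, [/\ marker t b = a :: rcons y a, 0 < size y,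
    k = 0 -> y = [:: a] & 0 < k -> a \notin y].
Proof.
case: t => // a [|z t] /= [<-] szb; first by exists a, [:: a].
case/andP=> at_ _; exists a, (expand (z :: t) b); split=> //.
  by case: b szb => //= e b _; rewrite /expand /= size_cat size_nseq.
by move=> _; apply: contra at_; apply: mem_expand.
Qed.

(** With [z] the word between the two occurrences, [w] contains a y a z a y a; the strict inequality
    makes [z] nonempty. *)
Lemma Z3_of_occurrences (T : eqType) (w y : seq T) a i j :
    0 < size y -> let m := a :: rcons y a in
    prefix m (drop i w) -> prefix m (drop j w) -> i + size m < j ->
  contains Z3 w.
Proof.
move=> y_gt0 m /prefixP[r def_r] /prefixP[r' def_r'] lt_ij.
pose z := take (j - i - size m) r.
have def_z : r = z ++ m ++ r'.
  rewrite -def_r' -[LHS](cat_take_drop (j - i - size m)); congr cat.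
  have ->: drop j w = drop (j - i) (drop i w).
    by rewrite drop_drop subnK //; lia.
  by rewrite def_r drop_cat ltnNge leq_subRL ?(ltnW lt_ij) //; lia.
have z_gt0 : 0 < size z.
  rewrite size_take_min.
  have := congr1 size def_r'; rewrite size_drop size_cat.
  have := congr1 size def_r; rewrite size_drop size_cat.
  by have : 0 < size m by []; lia.
exists (fun l => nth [::] [:: [::]; [:: a]; y; z] l); split.
  have nil0 (s : seq T) : 0 < size s -> s != [::] by case: s.
  by move=> l; rewrite !inE; do ![case/predU1P=> [->|]] => [||||||/eqP->] /=;
    rewrite ?nil0.
apply/infixP; exists (take i w), r'.
rewrite -[LHS](cat_take_drop i) def_r def_z /m; congr cat.
by rewrite /= -!cats1; do 3 rewrite -!catA /=.
Qed.

(** The first letter of the second occurrence falls inside the [y] of the first. *)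
Lemma mem_overlap (T : eqType) (w y : seq T) a i d :
    let m := a :: rcons y a in
    prefix m (drop i w) -> prefix m (drop (i + d) w) -> 0 < d <= size y ->
  a \in y.
Proof.
move=> m /prefixP[r def_r] /prefixP[r' def_r'] /andP[d_gt0 le_dy].
have := congr1 (nth a ^~ 0) def_r'.
rewrite nth_drop addn0 -nth_drop def_r nth_cat /m /= size_rcons ifT; last by lia.
case: d d_gt0 le_dy {def_r'} => // d _ lt_dy /=.
by rewrite nth_rcons lt_dy => <-; apply: mem_nth.
Qed.

(** The index [p] stands for the prefix of length [p.+1]; what follows the marker in it obeys the
    bound of [marker_decomp]. *)
Definition covered (T : finType) (w : seq T) k (m : seq T) (p : nat) : bool :=
  has (fun i => prefix m (drop i w) &&
      (i + size m <= p.+1 <= i + size m + 2 * (#|T| - k.+1) + (0 < k)))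
    (iota 0 (size w)).

Lemma card_ord_le_size n (P : pred nat) (l : seq nat) :
  (forall p, P p -> p \in l) -> #|[set p : 'I_n | P p]| <= size l.
Proof.
move=> Pl; rewrite cardE -(size_map val); apply: uniq_leq_size.
  by rewrite map_inj_uniq ?enum_uniq //; apply: val_inj.
by move=> y /mapP[p]; rewrite mem_enum inE => /Pl pl ->.
Qed.

Lemma card_covered (T : finType) (w : seq T) n k (t : seq T) b :
    ~ contains Z3 w -> size t = k.+1 -> size b = k -> uniq t ->
  #|[set p : 'I_n | covered w k (marker t b) p]| <= 4 * (#|T| - k).
Proof.
move=> noZ3 szt szb ut.
have ltkT : k < #|T| by rewrite -szt -(card_uniqP ut) max_card.
have [a [y [-> y_gt0 yk0 yk]]] := marker_shape szt szb ut.
set m := a :: rcons y a.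
have szm : size m = (size y).+2 by rewrite /= size_rcons.
have le_l := @card_ord_le_size n (covered w k m).
have [noocc|[i occ_i]] : (forall i, ~~ prefix m (drop i w)) \/
    exists i, prefix m (drop i w).
  have [/hasP[i _ ?]|/hasPn noi] := boolP (has (fun i => prefix m (drop i w))
    (iota 0 (size w))); [by right; exists i | left=> i].
  case: (ltnP i (size w)) => [ltiw|lewi]; first by rewrite noi // mem_iota.
  by rewrite drop_oversize.
  apply: leq_trans (le_l [::] _) _ => // p /hasP[i _].
  by rewrite (negPf (noocc i)).
case: (ex_minnP (ex_intro (fun i => prefix m (drop i w)) i occ_i)).
move=> i0 occ0 min0 {i occ_i}.
have near j : prefix m (drop j w) -> i0 <= j <= i0 + size m.
  move=> occ_j; rewrite min0 //= leqNgt; apply/negP=> lt_j.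
  exact: noZ3 (Z3_of_occurrences y_gt0 occ0 occ_j lt_j).
have [k0|k_gt0] := posnP k.
  (* Occurrences of a a a may overlap freely, but all start in [[i0, i0 + 3]], so the prefixes they
     serve fill one interval. *)
  pose l := iota (i0 + 2) (2 * #|T| + 2).
  apply: leq_trans (le_l l _) _ => [p|]; last first.
    by rewrite size_iota; move: ltkT; rewrite k0; move: #|T| => N; lia.
  case/hasP=> j _ /andP[/near]; rewrite mem_iota szm yk0 // k0 /=.
  by move: ltkT; rewrite k0; move: #|T| => N; lia.
have{yk} ay := negP (yk k_gt0).
(* As [a] is not in [y], a later occurrence either shares the final [a] of the first one or starts
   right after it. *)
have far j : prefix m (drop j w) ->
    [\/ j = i0, j = i0 + (size y).+1 | j = i0 + (size y).+2].
  move=> occ_j; have /andP[le_ij le_ji] := near j occ_j.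
  have [le_d|] := leqP (j - i0) (size y); last first.
    rewrite szm in le_ji; case: (eqVneq j (i0 + (size y).+1)) => [|ne] lt_d.
      by constructor 2.
    by constructor 3; lia.
  have [d0|d_gt0] := posnP (j - i0); first by constructor 1; lia.
  case: ay; apply: (mem_overlap (d := j - i0) occ0); last by rewrite d_gt0.
  by rewrite subnKC.
(* The two later positions differ by 1 and exclude each other, again by overlap. *)
have [i1 two] : exists i1, forall j, prefix m (drop j w) -> j = i0 \/ j = i1.
  have [occ1|nocc1] := boolP (prefix m (drop (i0 + (size y).+1) w)).
    exists (i0 + (size y).+1) => j occ_j.
    case: (far j occ_j); [by left | by right | move=> def_j].
    case: ay; apply: (mem_overlap (d := 1) occ1) => //.
    by rewrite addn1 -addnS -def_j.
  exists (i0 + (size y).+2) => j occ_j.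
  case: (far j occ_j) => [->|def_j|->]; [by left | | by right].
  by move: nocc1; rewrite -def_j occ_j.
(* The tail length ranges from 0 to [2 * (#|T| - k.+1) + 1], which gives [M] values. *)
pose M := 2 * (#|T| - k).
pose l := iota (i0 + (size y).+1) M ++ iota (i1 + (size y).+1) M.
apply: leq_trans (le_l l _) _ => [p|]; last first.
  by rewrite size_cat !size_iota /M; lia.
case/hasP=> j _ /andP[/two def_j]; rewrite mem_cat !mem_iota szm k_gt0 /M.
move: ltkT; move: #|T| => N ltkN; case: def_j => ->; lia.
Qed.

(** * Counting prefixes by their markers *)

Lemma mem_covered (T : finType) (w : seq T) p :
    p < size w -> 2 * #|T| <= p ->
  exists k t b, [/\ size t = k.+1, size b = k, uniq t
    & covered w k (marker t b) p].
Proof.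
move=> lt_p le_p; have szs : size (take p.+1 w) = p.+1 by rewrite size_takel.
have notZ2 : ~~ Z2free (take p.+1 w).
  apply/negP=> /size_Z2free; rewrite szs => le_u.
  have: #|undup (take p.+1 w)| <= #|T| by exact: max_card.
  rewrite (card_uniqP (undup_uniq _)) => le_u'.
  by have := leq_trans (leq_trans (leq_mul (leqnn 2) le_u') le_p) (leqnn p);
    move/(leq_trans le_u); rewrite ltnn.
have [s0 [x [s' [def_s Zs' xs']]]] := last_Z2 notZ2.
have [k [t [b [r [[szt szb ut] def_m szr]]]]] := marker_decomp Zs' xs'.
exists k, t, b; split=> //; apply/hasP; exists (size s0).
  rewrite mem_iota /= add0n; apply: leq_trans lt_p.
  by rewrite -szs def_s size_cat /= addnS ltnS leq_addr.
apply/andP; split.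
  rewrite -(cat_take_drop p.+1 w) def_s -catA drop_size_cat // def_m -catA.
  exact: prefix_prefix.
have: p.+1 = size s0 + (size (marker t b) + size r).
  by rewrite -szs def_s def_m !size_cat.
by move=> ->; rewrite addnA leq_addr -(addnA _ (2 * _)) leq_add2l.
Qed.

Lemma card_bigcup_le (I T : finType) (P : pred I) (F : I -> {set T}) c :
  (forall i, P i -> #|F i| <= c i) ->
  #|\bigcup_(i | P i) F i| <= \sum_(i | P i) c i.
Proof.
move=> le_c; apply: leq_trans (leq_sum _ le_c).
elim/big_rec2: _ => [|i u v _ IHi]; first by rewrite cards0.
by apply: leq_trans (leq_card_setU _ _) _; rewrite leq_add2l.
Qed.

Lemma size_noZ3 (T : finType) (w : seq T) : ~ contains Z3 w ->
  size w <= 2 * #|T| +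
    \sum_(k < #|T|) #|T| ^_ k.+1 * (2 ^ k * (4 * (#|T| - k))).
Proof.
move=> noZ3; rewrite -[leqLHS]card_ord -[leqLHS]cardsT.
(* [A] takes the prefixes of length at most [2 * #|T|], which may have no marker; [B] takes those
   served by some marker. *)
pose A := [set p : 'I_(size w) | p < 2 * #|T|].
pose B := \bigcup_(k < #|T|)
  \bigcup_(t in [set t : k.+1.-tuple T | all T t & uniq t])
  \bigcup_(b : k.-tuple bool)
    [set p : 'I_(size w) | covered w k (marker t b) p].
have sub : [set: 'I_(size w)] \subset A :|: B.
  apply/fintype.subsetP=> p _; rewrite !inE.
  case: ltnP => [lt_p|le_p]; first by [].
  have [k [t [b [szt szb ut cov]]]] := mem_covered (ltn_ord p) le_p.
  apply/orP; right.
  have ltkT : k < #|T| by rewrite -szt -(card_uniqP ut) max_card.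
  apply/finset.bigcupP; exists (Ordinal ltkT) => //=.
  apply/finset.bigcupP; exists (Tuple (introT eqP szt)).
    by rewrite inE /= ut andbT; apply/allP.
  by apply/finset.bigcupP; exists (Tuple (introT eqP szb)); rewrite // inE.
apply: leq_trans (subset_leq_card sub) _.
apply: leq_trans (leq_card_setU _ _) _; apply: leq_add.
  rewrite -[leqRHS](size_iota 0).
  apply: (@card_ord_le_size _ (fun p => p < 2 * #|T|)) => p.
  by rewrite mem_iota.
apply: card_bigcup_le => k _.
rewrite -[#|T| ^_ _](@card_uniq_tuples T k.+1 T) -sum_nat_const.
apply: card_bigcup_le => t; rewrite inE => /andP[_ ut].
rewrite -[in 2 ^ _]card_bool -card_tuple -sum_nat_const.
apply: card_bigcup_le => b _.
by apply: card_covered; rewrite ?size_tuple.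
Qed.

(** * Comparison with the exponential series *)

Section PartialSums.
Local Open Scope ring_scope.
Variable R : realType.

Lemma exp_partial_sum_le (x : R) n : 0 <= x ->
  \sum_(j < n) x ^+ j / j`!%:R <= expR x.
Proof.
move=> x_ge0; have := nondecreasing_cvgn_le _ (is_cvg_series_exp_coeff x) n.
rewrite /series /= big_mkord; apply.
apply/nondecreasing_seqP => m; rewrite /series /= big_nat_recr //= lerDl.
exact: exp_coeff_ge0.
Qed.

(** Split [j.+1] as [j + 1]: since [j / j!] is [1 / (j - 1)!], the first part is half a partial sum
    of the series, and the second is a partial sum itself. *)
Lemma succ_exp_partial_sum_le n :
  \sum_(j < n.+1) j.+1%:R * ((1 / 2) ^+ j / j`!%:R) <= 3 / 2 * expR (1 / 2) :> R.
Proof.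
have half_ge0 : 0 <= 1 / 2 :> R by lra.
under eq_bigr => j _ do rewrite -addn1 natrD mulrDl [1 * (_ / _)]mul1r.
rewrite big_split /= big_ord_recl mul0r add0r.
have -> : \sum_(j < n) (lift ord0 j)%:R * ((1 / 2) ^+ lift ord0 j / (lift ord0 j)`!%:R)
    = 1 / 2 * \sum_(j < n) ((1 / 2) ^+ j / j`!%:R) :> R.
  rewrite mulr_sumr; apply: eq_bigr => j _.
  rewrite lift0 factS natrM exprS.
  by field; rewrite !pnatr_eq0 -lt0n fact_gt0 nat1r pnatr_eq0.
have := exp_partial_sum_le n half_ge0; have := exp_partial_sum_le n.+1 half_ge0.
lra.
Qed.

(* The tail term [j = q] of the exponential-type series is worth [2 (q + 1)] and
   absorbs the [2 q + 1]. *)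
Lemma bound_lt q :
  (2 * q + \sum_(k < q) q ^_ k.+1 * (2 ^ k * (4 * (q - k)))).+1%:R
    < 3 * expR (1 / 2) * 2 ^+ q * (q`!)%:R :> R.
Proof.
pose g j : R := j.+1%:R * ((1 / 2) ^+ j / j`!%:R).
have fact_neq0 j : j`!%:R != 0 :> R by rewrite pnatr_eq0 -lt0n fact_gt0.
have sumE : (\sum_(k < q) q ^_ k.+1 * (2 ^ k * (4 * (q - k))))%:R
    = 2 * 2 ^+ q * (q`!)%:R * \sum_(j < q) g j.
  rewrite (reindex_inj rev_ord_inj) /= natr_sum mulr_sumr; apply: eq_bigr => j _.
  have lt_jq := ltn_ord j.
  have -> : (q - (q - j.+1) = j.+1)%N by lia.
  have -> : ((q - j.+1).+1 = q - j)%N by lia.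
  (* The falling factorial is [q! / j!], and [4 * 2 ^ (q - 1 - j)] is [2 * 2 ^ q / 2 ^ j]. *)
  have := ffact_fact (leq_subr j q); rewrite subKn ?(ltnW lt_jq) // => def_q.
  rewrite -def_q !natrM !natrX.
  have -> : 2 ^+ q = 2 ^+ (q - j.+1) * 2 ^+ j * 2 :> R.
    by rewrite -exprD -exprSr; congr (_ ^+ _); lia.
  rewrite /g expr_div_n expr1n.
  by field; rewrite fact_neq0 expf_neq0.
have le_sum : \sum_(j < q) g j + g q <= 3 / 2 * expR (1 / 2).
  by have := succ_exp_partial_sum_le q; rewrite big_ord_recr.
have c_gt0 : 0 < 2 * 2 ^+ q * (q`!)%:R :> R.
  by rewrite !mulr_gt0 ?exprn_gt0 ?ltr0n ?fact_gt0.
have gq : 2 * 2 ^+ q * (q`!)%:R * g q = 2 * q.+1%:R.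
  rewrite /g expr_div_n expr1n.
  by field; rewrite fact_neq0 expf_neq0.
have := ler_wpM2l (ltW c_gt0) le_sum; rewrite mulrDr gq => le_bound.
rewrite -addn1 natrD (natrD _ (2 * q)%N) sumE natrM.
have : q.+1%:R = q%:R + 1 :> R by rewrite -addn1 natrD.
have -> : 3 * expR (1 / 2) * 2 ^+ q * (q`!)%:R
  = 2 * 2 ^+ q * (q`!)%:R * (3 / 2 * expR (1 / 2)) :> R by field.
move: le_bound; set S := _ * bigop _ _ _; set E := _ * (3 / 2 * _).
by move: (q.+1%:R) (q%:R) S E => v u S E; lra.
Qed.

End PartialSums.

Theorem theorem5p1 (R : realType) (q : nat) (q_gt3 : (3 < q)%N) :
  exists n : nat, is_f3 q n /\
    (n%:R < 3 * expR (1 / 2) * 2 ^+ q * (q`!)%:R :> R)%R.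
Proof.
pose N := 2 * q + \sum_(k < q) q ^_ k.+1 * (2 ^ k * (4 * (q - k))).
have forcesN : forces_Z3 q N.+1.
  move=> w; apply: contrapT => /size_noZ3.
  by rewrite size_tuple card_ord ltnn.
(* Classical truth makes the predicate boolean, so that a least length can be extracted. *)
have exn : exists n, `[< forces_Z3 q n >] by exists N.+1; apply/asboolP.
case: (ex_minnP exn) => n /asboolP forces_n min_n.
exists n; split; first by split=> // m /asboolP; apply: min_n.
apply: le_lt_trans (bound_lt R q); rewrite ler_nat.
by apply: min_n; apply/asboolP.
Qed.
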